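(* Let $k$ be a positive integer. The set $\mathcal{B}_{2k-1,2k-1}\subset\mathcal{P}_{2k,2k}(\mathbb{R})$ is not closed in the norm topology. Furthermore, its closure is $\overline{\mathcal{B}_{2k-1,2k-1}}=\mathcal{B}_{2k,2k-1}\subset\mathcal{P}_{2k,2k}(\mathbb{R})$.
   Context: $\mathcal{P}_{m,n}(\mathbb{R})$ is the real vector space of $m\times n$ pencils $A+\lambda B$ with $A,B\in\mathbb{R}^{m\times n}$, with the norm $\|A+\lambda B\|=\sqrt{\|A\|^2+\|B\|^2}$ (Frobenius norms) and the induced topology. The group $\mathrm{GL}_{m,n,2}(\mathbb{R})=\mathrm{GL}_m(\mathbb{R})\times\mathrm{GL}_n(\mathbb{R})\times\mathrm{GL}_2(\mathbb{R})$ acts by $$(P,U,T)\cdot(A+\lambda B)=P(t_{11}A+t_{12}B)U^{\sf T}+\lambda P(t_{21}A+t_{22}B)U^{\sf T},\quad T=(t_{ij}),$$ and $\mathcal{O}(A,B)$ is the orbit of $A+\lambda B$. For integers $r\ge s\ge0$, $$\mathcal{B}_{r,s}=\{A+\lambda B\in\mathcal{P}_{m,n}(\mathbb{R}) : \exists\,A'+\lambda B'\in\mathcal{O}(A,B)\text{ with }\operatorname{rank}A'\le r,\ \operatorname{rank}B'\le s\}.$$ Here $m=n=2k$. *)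

(* Defs.v *)
From HB Require Import structures.
From mathcomp Require Import all_boot all_order all_algebra.
From mathcomp Require Import all_classical all_reals all_analysis.
From mathcomp Require Import ring.

Set Implicit Arguments.
Unset Strict Implicit.
Unset Printing Implicit Defensive.

Import Order.TTheory GRing.Theory Num.Theory.
Import numFieldNormedType.Exports.

Local Open Scope classical_set_scope.
Local Open Scope ring_scope.

(* The pair (A, B) stands for the pencil A + lambda B. This is an alias of the
   product type, so that it can carry the norm below instead of the max norm
   that the library puts on matrices and on products. *)
Definition pencil (R : realType) (m n : nat) : Type :=
  ('M[R]_(m, n) * 'M[R]_(m, n))%type.

HB.instance Definition _ (R : realType) (m n : nat) :=
  GRing.Lmodule.copy (pencil R m n) ('M[R]_(m, n) * 'M[R]_(m, n))%type.

Definition frobenius_norm (R : realType) (m n : nat) (A : 'M[R]_(m, n)) : R :=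
  Num.sqrt (\sum_i \sum_j A i j ^+ 2).

Definition pencil_norm (R : realType) (m n : nat) (p : pencil R m n) : R :=
  Num.sqrt (frobenius_norm p.1 ^+ 2 + frobenius_norm p.2 ^+ 2).

Section PencilNorm.
Variables (R : realType) (m n : nat).
Implicit Types p q : pencil R m n.

Lemma minkowski_sum (I : finType) (a b : I -> R) :
  Num.sqrt (\sum_i (a i + b i) ^+ 2) <=
  Num.sqrt (\sum_i a i ^+ 2) + Num.sqrt (\sum_i b i ^+ 2).
Proof.
have sq0 (f : I -> R) : 0 <= \sum_i f i ^+ 2.
  by apply: sumr_ge0 => i _; exact: sqr_ge0.
set x := Num.sqrt (\sum_i a i ^+ 2); set y := Num.sqrt (\sum_i b i ^+ 2).
have x0 : 0 <= x by exact: sqrtr_ge0.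
have y0 : 0 <= y by exact: sqrtr_ge0.
have xE : x ^+ 2 = \sum_i a i ^+ 2 by rewrite sqr_sqrtr.
have yE : y ^+ 2 = \sum_i b i ^+ 2 by rewrite sqr_sqrtr.
have zero (f : I -> R) : \sum_i f i ^+ 2 = 0 -> forall i, f i = 0.
  move=> /eqP; rewrite psumr_eq0 => [/allP h i|i _]; last exact: sqr_ge0.
  by apply/eqP; rewrite -sqrf_eq0; apply: h; rewrite mem_index_enum.
have cs : \sum_i a i * b i <= x * y.
  have [xy0|xy0] := eqVneq (x * y) 0.
    rewrite xy0 big1// => i _; move/eqP: xy0; rewrite mulf_eq0 => /orP[]/eqP h.
      by move: xE; rewrite h expr0n/= => /esym/zero ->; rewrite mul0r.
    by move: yE; rewrite h expr0n/= => /esym/zero ->; rewrite mulr0.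
  have xy_gt0 : 0 < x * y by rewrite lt_def xy0 mulr_ge0.
  have := sq0 (fun i => y * a i - x * b i).
  have -> : \sum_i (y * a i - x * b i) ^+ 2 =
      2 * (x * y) * (x * y - \sum_i a i * b i).
    transitivity (y ^+ 2 * \sum_i a i ^+ 2 + x ^+ 2 * \sum_i b i ^+ 2 -
        2 * (x * y) * \sum_i a i * b i); last by rewrite -xE -yE; ring.
    rewrite !mulr_sumr -big_split/= -sumrB; apply: eq_bigr => i _; ring.
  by rewrite pmulr_rge0 ?subr_ge0// mulr_gt0.
rewrite -(ger0_norm (addr_ge0 x0 y0)) -sqrtr_sqr ler_wsqrtr// sqrrD xE yE.
rewrite (eq_bigr (fun i => a i ^+ 2 + 2 * (a i * b i) + b i ^+ 2)) => [|i _];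
  last by ring.
rewrite !big_split/= lerD2r lerD2l -mulr_sumr -(mulr_natl (x * y)).
by rewrite ler_pM2l.
Qed.

Let coef p (i : bool * ('I_m * 'I_n)) : R :=
  (if i.1 then p.1 else p.2) i.2.1 i.2.2.

Let pencil_normE p : pencil_norm p = Num.sqrt (\sum_i coef p i ^+ 2).
Proof.
rewrite /pencil_norm !sqr_sqrtr; [|by do 2![apply: sumr_ge0 => ? _]; exact: sqr_ge0..].
congr Num.sqrt; rewrite !pair_bigA/=.
rewrite -(pair_bigA _ (fun b (j : 'I_m * 'I_n) => coef p (b, j) ^+ 2))/=.
by rewrite big_bool.
Qed.

Lemma pencil_normD p q : pencil_norm (p + q) <= pencil_norm p + pencil_norm q.
Proof.
rewrite !pencil_normE; apply: le_trans (minkowski_sum _ _).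
rewrite le_eqVlt; apply/orP; left; apply/eqP; congr Num.sqrt.
by apply: eq_bigr => -[[] [i j]] _; rewrite /coef/= mxE.
Qed.

Lemma pencil_normZ (l : R) p : pencil_norm (l *: p) = `|l| * pencil_norm p.
Proof.
rewrite !pencil_normE -sqrtr_sqr -sqrtrM ?sqr_ge0// mulr_sumr.
congr Num.sqrt.
by apply: eq_bigr => -[[] [i j]] _; rewrite /coef/= mxE exprMn.
Qed.

Lemma pencil_norm0_eq0 p : pencil_norm p = 0 -> p = 0.
Proof.
rewrite pencil_normE => /eqP; rewrite sqrtr_eq0 => le0.
have : \sum_i coef p i ^+ 2 == 0.
  by rewrite eq_le le0 sumr_ge0// => i _; exact: sqr_ge0.
rewrite psumr_eq0 => [/allP h|i _]; last exact: sqr_ge0.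
have {}h i : coef p i = 0.
  by apply/eqP; rewrite -sqrf_eq0; apply: h; rewrite mem_index_enum.
case: p h {le0} => A B h; congr (_, _); apply/matrixP => i j; rewrite mxE.
- exact: (h (true, (i, j))).
- exact: (h (false, (i, j))).
Qed.

HB.instance Definition _ := Lmodule_isNormed.Build R (pencil R m n)
  pencil_normD pencil_normZ pencil_norm0_eq0.

End PencilNorm.

Definition pencil_act (R : realType) (m n : nat)
    (P : 'M[R]_m) (U : 'M[R]_n) (T : 'M[R]_2) (p : pencil R m n)
    : pencil R m n :=
  (P *m (T 0 0 *: p.1 + T 0 1 *: p.2) *m U^T,
   P *m (T 1 0 *: p.1 + T 1 1 *: p.2) *m U^T).

Definition pencil_orbit (R : realType) (m n : nat) (p : pencil R m n)
    : set (pencil R m n) :=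
  [set q | exists (P : 'M[R]_m) (U : 'M[R]_n) (T : 'M[R]_2),
     [/\ P \in unitmx, U \in unitmx, T \in unitmx & q = pencil_act P U T p]].

Definition Brs (R : realType) (m n r s : nat) : set (pencil R m n) :=
  [set p | exists q, [/\ pencil_orbit p q,
     (\rank q.1 <= r)%N & (\rank q.2 <= s)%N]].
Arguments Brs : clear implicits.

(* Main.v *)
(* A pencil [A + lambda B] of size [n = 2k] lies in [B_{n,n-1}] iff the binary
   form [det (x A + y B)] has a real projective root, and in [B_{n-1,n-1}] iff it
   has two distinct ones. The first condition is closed because the projective
   line is compact. Conversely, given one root, a change of basis makes [B]
   singular, and a small perturbation turns it into a simple root; as the form
   has even degree, this sign change forces a second real root. The pencil
   [(I, 0)], whose form is [x ^ n], separates the two sets. *)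
Require Import Defs.
From mathcomp Require Import all_boot all_order all_algebra.
From mathcomp Require Import all_classical all_reals all_analysis.
From mathcomp Require Import ring lra zify.

Set Implicit Arguments.
Unset Strict Implicit.
Unset Printing Implicit Defensive.

Import Order.TTheory GRing.Theory Num.Theory.
Import numFieldNormedType.Exports.

Local Open Scope classical_set_scope.
Local Open Scope ring_scope.

(** * Rank conditions as roots of a binary form *)

Lemma mxrank_leq_det0 (F : fieldType) (n : nat) (M : 'M[F]_n) :
  (0 < n)%N -> (\rank M <= n - 1)%N = (\det M == 0).
Proof.
move=> n0; rewrite -[RHS]negbK -unitfE -unitmxE -row_free_unit /row_free.
have := rank_leq_row M; lia.
Qed.

Lemma det_mx2 (F : comNzRingType) (T : 'M[F]_2) :
  \det T = T 0 0 * T 1 1 - T 0 1 * T 1 0.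
Proof.
rewrite (expand_det_row _ 0) !big_ord_recl big_ord0 /cofactor !det_mx11 !mxE.
rewrite /= addr0 expr0 expr1 mul1r mulN1r mulrN.
have -> : lift 0 0 = 1 :> 'I_2 by apply/val_inj.
by have -> : lift 1 0 = 0 :> 'I_2 by apply/val_inj.
Qed.

Section Membership.
Variables (R : realType) (n : nat).
Hypothesis n_gt0 : (0 < n)%N.
Implicit Type p : pencil R n n.

(** Multiplying by the invertible [P] and [U] preserves both ranks, so only [T] matters; its rows
    are [(a, b)] and [(c, d)]. *)
Lemma mem_Brs_det p (r s : nat) : Brs R n n r s p <->
  exists a b c d : R, [/\ a * d - b * c != 0,
    (\rank (a *: p.1 + b *: p.2)%R <= r)%N &
    (\rank (c *: p.1 + d *: p.2)%R <= s)%N].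
Proof.
split=> [[q [[P [U [T [Pu Uu Tu ->]]]]]]|[a [b [c [d [dt hr hs]]]]]].
  have rk (M : 'M[R]_n) : \rank (P *m M *m U^T) = \rank M.
    rewrite mxrankMfree ?row_free_unit ?unitmx_tr//.
    by rewrite -mxrank_tr trmx_mul mxrankMfree ?row_free_unit ?unitmx_tr// mxrank_tr.
  rewrite /= !rk => hr hs; exists (T 0 0), (T 0 1), (T 1 0), (T 1 1); split=> //.
  by move: Tu; rewrite unitmxE unitfE det_mx2.
pose T : 'M[R]_2 := \matrix_(i, j)
  if i == 0 then (if j == 0 then a else b) else (if j == 0 then c else d).
exists (pencil_act 1%:M 1%:M T p); split.
- exists 1%:M, 1%:M, T; split; rewrite ?unitmx1// unitmxE unitfE det_mx2.
  by rewrite !mxE.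
- by rewrite /= !mxE /= mul1mx trmx1 mulmx1.
- by rewrite /= !mxE /= mul1mx trmx1 mulmx1.
Qed.

Lemma mem_Brs_corank1 p : Brs R n n n (n - 1) p <->
  exists c d : R, (c != 0) || (d != 0) /\ \det (c *: p.1 + d *: p.2) = 0.
Proof.
rewrite mem_Brs_det; split=> [[a [b [c [d [dt _ hs]]]]]|[c [d [cd ht]]]].
  exists c, d; split; last by apply/eqP; rewrite -mxrank_leq_det0.
  rewrite -negb_and; apply: contra dt => /andP[/eqP-> /eqP->].
  by rewrite !mulr0 subr0.
(* The row [(d, - c)] is orthogonal to [(c, d)]; the determinant is c^2 + d^2, which is nonzero over
   the reals. *)
exists d, (- c), c, d; split; rewrite ?rank_leq_row//.
  by rewrite mulNr opprK -!expr2 paddr_eq0 ?sqr_ge0// !sqrf_eq0 negb_and orbC.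
by rewrite mxrank_leq_det0// ht.
Qed.

Lemma mem_Brs_corank11 p : Brs R n n (n - 1) (n - 1) p <->
  exists a b c d : R, [/\ a * d - b * c != 0,
    \det (a *: p.1 + b *: p.2) = 0 & \det (c *: p.1 + d *: p.2) = 0].
Proof.
rewrite mem_Brs_det; split=> -[a [b [c [d [dt hr hs]]]]];
  exists a, b, c, d; split=> //.
- by apply/eqP; rewrite -mxrank_leq_det0.
- by apply/eqP; rewrite -mxrank_leq_det0.
- by rewrite mxrank_leq_det0// hr.
- by rewrite mxrank_leq_det0// hs.
Qed.

End Membership.

(** * Existence of a second real root after perturbation *)

Lemma det_scale_rows (F : comNzRingType) (n : nat) (d : 'I_n -> F) (M : 'M[F]_n) :
  \det (\matrix_(i, j) (d i * M i j)) = (\prod_i d i) * \det M.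
Proof.
have -> : \matrix_(i, j) (d i * M i j) = diag_mx (\row_i d i) *m M.
  by apply/matrixP => i j; rewrite mul_diag_mx !mxE.
by rewrite det_mulmx det_diag; congr (_ * _); apply: eq_bigr => i _; rewrite mxE.
Qed.

(** The root [(0, 1)] is simple: the coefficient of x y^m is the last diagonal entry of [A] times
    the product of the nonzero [b i]. Dividing by x leaves a form of odd degree m, which changes
    sign between antipodal points and so vanishes somewhere with x nonzero. *)
Lemma pencil_second_root (R : realType) (m : nat)
    (A : 'M[R]_m.+1) (b : 'I_m.+1 -> R) :
  odd m -> A ord_max ord_max != 0 ->
  (forall i, (b i == 0) = (i == ord_max)) ->
  exists x y : R, x != 0 /\ \det (x *: A + y *: diag_mx (\row_i b i)) = 0.
Proof.
move=> oddm Ann bP; set B := diag_mx _.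
have b0 : b ord_max = 0 by apply/eqP; rewrite bP.
(* [M x y] is [x A + y B] with its last row, a multiple of [x], divided by [x]. *)
pose M (x y : R) : 'M[R]_m.+1 := \matrix_(i, j)
  if i == ord_max then A i j else x * A i j + y * B i j.
have fM x y : \det (x *: A + y *: B) = x * \det (M x y).
  have -> : x *: A + y *: B =
      \matrix_(i, j) ((if i == ord_max then x else 1) * M x y i j).
    apply/matrixP => i j; rewrite !mxE; case: (i =P ord_max) => [->|_].
      by rewrite b0 mul0rn mulr0 addr0.
    by rewrite mul1r.
  by rewrite det_scale_rows -big_mkcond big_pred1_eq.
(* Negating the point negates all rows but the last, an odd number of them. *)
have MN x y : \det (M (- x) (- y)) = - \det (M x y).
  have -> : M (- x) (- y) =
      \matrix_(i, j) ((if i == ord_max then 1 else -1) * M x y i j).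
    apply/matrixP => i j; rewrite !mxE; case: (i =P ord_max) => _.
      by rewrite mul1r.
    by ring.
  rewrite det_scale_rows big_ord_recr /= eqxx mulr1.
  rewrite (eq_bigr (fun=> -1)) => [|i _]; last first.
    by rewrite ifN// -val_eqE /= ltn_eqF.
  by rewrite big_const_ord iter_mulr_1 -signr_odd oddm expr1 mulN1r.
(* At [(0, 1)] all rows but the last come from the diagonal [B], so the matrix is lower triangular
   with nonzero diagonal. *)
have M01 : \det (M 0 1) != 0.
  have : is_trig_mx (M 0 1).
    apply/is_trig_mxP => i j ij; rewrite !mxE.
    rewrite ifN; last by rewrite -val_eqE /= ltn_eqF// (leq_trans ij)// -ltnS.
    by rewrite mul0r add0r mul1r -val_eqE ltn_eqF.
  move=> /det_trig->; apply/prodf_neq0 => i _; rewrite !mxE.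
  case: (i =P ord_max) => [->//|/eqP ni]; rewrite mul0r add0r mul1r eqxx mulr1n.
  by rewrite bP.
(* The arc [(1 - s^2, s)] joins [(0, -1)] to [(0, 1)] and meets [x = 0] only
   at its ends. *)
pose Mp : 'M[{poly R}]_m.+1 := \matrix_(i, j)
  if i == ord_max then (A i j)%:P else (1 - 'X^2) * (A i j)%:P + 'X * (B i j)%:P.
have MpE s : (\det Mp).[s] = \det (M (1 - s ^+ 2) s).
  rewrite -[LHS]/(horner_eval s (\det Mp)) -det_map_mx; congr (\det _).
  apply/matrixP => i j; rewrite !mxE -[LHS]/(_.[s]).
  by case: (i =P ord_max) => _; rewrite !hornerE.
(* The factor [(\det Mp).[1]] fixes the signs at the ends: [q] is minus a square at -1 and the same
   square at 1. *)
pose q := \det Mp * (\det Mp).[1]%:P.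
have qE s : q.[s] = (\det Mp).[s] * (\det Mp).[1] by rewrite hornerM hornerC.
have MpN1 : (\det Mp).[-1] = - (\det Mp).[1].
  by rewrite !MpE sqrrN expr1n subrr -[in LHS]oppr0 MN.
have Mp1 : (\det Mp).[1] = \det (M 0 1) by rewrite MpE expr1n subrr.
have [||s /andP[s1 s2]] := @poly_ivt _ q (-1) 1.
- by lra.
- by rewrite !qE MpN1 mulNr oppr_le0 -expr2 sqr_ge0.
rewrite /root qE Mp1 mulf_eq0 (negbTE M01) orbF => /eqP r.
exists (1 - s ^+ 2), s; split; last by rewrite fM -MpE r mulr0.
(* If x were zero, s would be an end of the arc, where the determinant is plus or minus the nonzero
   [\det (M 0 1)]. *)
apply/eqP => /subr0_eq/esym/eqP; rewrite sqrf_eq1.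
move=> /orP[]/eqP se; move: r M01; rewrite se ?MpN1 Mp1 => /eqP.
  by move->.
by rewrite oppr_eq0 => ->.
Qed.

(** In bases where [B] is diagonal with entries 1 and 0, [F] raises its rank to m while keeping the
    last entry zero, and [E] makes the last diagonal entry of [A] nonzero. Then [pencil_second_root]
    applies. *)
Lemma pencil_perturb_second_root (R : realType) (m : nat) (A B : 'M[R]_m.+1) :
  odd m -> \det B = 0 ->
  exists E F : 'M[R]_m.+1, forall t, 0 < t ->
    \det (B + t *: F) = 0 /\
    exists x y : R, x != 0 /\ \det (x *: (A + t *: E) + y *: (B + t *: F)) = 0.
Proof.
move=> oddm dB; have rB : (\rank B <= m)%N.
  by have := mxrank_leq_det0 B (ltn0Sn m); rewrite subSS subn0 dB eqxx.
set L := col_ebase B; set U := row_ebase B.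
have Lu : L \in unitmx by exact: col_ebase_unit.
have Uu : U \in unitmx by exact: row_ebase_unit.
have [A' AE] : exists A', A = L *m A' *m U.
  by exists (invmx L *m A *m invmx U); rewrite !mulmxA mulmxV// mul1mx mulmxKV.
(* This sign pushes the corner entry away from zero, so that no positive t cancels it. *)
pose e : R := if A' ord_max ord_max < 0 then -1 else 1.
pose b t (i : 'I_m.+1) : R := (i < \rank B)%:R + t * (i < m)%:R.
have b0 t i : 0 < t -> (b t i == 0) = (i == ord_max).
  move=> t0; rewrite /b -(inj_eq val_inj)/=; have := ltn_ord i.
  rewrite ltnS leq_eqVlt => /orP[/eqP->|im].
    by rewrite ltnn eqxx ltnNge rB mulr0 addr0 eqxx.
  rewrite im ltn_eqF// mulr1; apply/negbTE/lt0r_neq0.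
  by rewrite ltr_wpDl// ler0n.
have BE t : B + t *: (L *m pid_mx m *m U) = L *m diag_mx (\row_i b t i) *m U.
  rewrite -{1}(mulmx_ebase B) -/L -/U scalemxAl scalemxAr -mulmxDl -mulmxDr.
  congr (_ *m _ *m _); apply/matrixP => i j; rewrite !mxE /b -val_eqE.
  by case: (val i == j); rewrite ?mulr0 ?addr0.
exists (L *m (e *: delta_mx ord_max ord_max) *m U), (L *m pid_mx m *m U) => t t0.
rewrite BE; split.
  rewrite !det_mulmx det_diag (bigD1 ord_max)//= mxE.
  have /eqP-> : b t ord_max == 0 by rewrite b0.
  by rewrite mul0r mulr0 mul0r.
have [] := @pencil_second_root _ _
    (A' + t *: (e *: delta_mx ord_max ord_max)) (b t) oddm _ _.
- rewrite !mxE !eqxx mulr1 /e; case: ltP => hA.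
    by rewrite mulrN1 lt_eqF// subr_lt0 (lt_trans hA t0).
  by rewrite mulr1 gt_eqF// ltr_wpDl.
- by move=> i; exact: b0.
move=> x [y [x0 dxy]]; exists x, y; split=> //.
rewrite AE [t *: (L *m _ *m U)]scalemxAl scalemxAr -mulmxDl -mulmxDr.
rewrite ![_ *: (L *m _ *m U)]scalemxAl ![_ *: (L *m _)]scalemxAr -mulmxDl -mulmxDr.
by rewrite !det_mulmx dxy mulr0 mul0r.
Qed.

(** * Approximation by pencils with two distinct roots *)

Lemma Brs_corank1_sub_closure (R : realType) (n : nat) : (0 < n)%N -> ~~ odd n ->
  Brs R n n n (n - 1) `<=` closure (Brs R n n (n - 1) (n - 1)).
Proof.
case: n => // m _ /negPn/= oddm p /(mem_Brs_corank1 (ltn0Sn m))[c [d [cd dp]]].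
have N0 : c ^+ 2 + d ^+ 2 != 0.
  by rewrite paddr_eq0 ?sqr_ge0// !sqrf_eq0 negb_and.
have [E [F EF]] := pencil_perturb_second_root (d *: p.1 - c *: p.2) oddm dp.
pose N := (c ^+ 2 + d ^+ 2)^-1.
(* The preimage of [(E, F)] under the change of basis taking [(p.1, p.2)] to [(d *: p.1 - c *: p.2,
   c *: p.1 + d *: p.2)]; [N] is the inverse of its determinant. *)
pose q : pencil R m.+1 m.+1 := (N *: (d *: E + c *: F), N *: (d *: F - c *: E)).
have pq t : 0 < t -> Brs R m.+1 m.+1 (m.+1 - 1) (m.+1 - 1) (p + t *: q).
  move=> /EF[dB [x [y [x0 dA]]]]; apply/mem_Brs_corank11 => //.
  (* The second root [(x, y)], rewritten in the original coordinates; it is independent of [(c, d)]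
     because x is nonzero. *)
  exists (x * d + y * c), (y * d - x * c), c, d; split.
  - have -> : (x * d + y * c) * d - (y * d - x * c) * c = x * (c ^+ 2 + d ^+ 2).
      by ring.
    by rewrite mulf_neq0.
  - rewrite -dA; congr (\det _); apply/matrixP => i j; rewrite !mxE /N.
    by field.
  - rewrite -dB; congr (\det _); apply/matrixP => i j; rewrite !mxE /N.
    by field.
apply: (@closed_cvg _ _ (0^'+) _ (fun t => p + t *: q)).
- exact: closed_closure.
- by near=> t; apply/subset_closure/pq; near: t; exact: nbhs_right_gt.
- rewrite -[X in _ --> X]addr0 -[X in _ --> _ + X](scale0r q).
  apply: cvgD; first exact: cvg_cst.
  by apply: cvgZr_tmp; apply: cvg_at_right_filter; exact: cvg_id.
Unshelve. all: by end_near.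
Qed.

(** * Closedness of the set of pencils with a real root *)

(** Convergence is asked entrywise because pencils carry the Frobenius norm rather than the library
    topology of matrices. *)
Lemma cvg_det (R : realType) (n : nat) (T : Type) (F : set_system T)
    (FF : Filter F) (M : T -> 'M[R]_n) (N : 'M[R]_n) :
  (forall i j, M x i j @[x --> F] --> N i j) -> \det (M x) @[x --> F] --> \det N.
Proof.
move=> MN; apply: cvg_big => [|s _]; first exact: add_continuous.
apply: cvgM; first exact: cvg_cst.
by apply: cvg_big => [|i _]; [exact: mul_continuous|exact: MN].
Qed.

Section EntryContinuity.
Variables (R : realType) (m n : nat).

Lemma sqr_entry_le_frobenius (A : 'M[R]_(m, n)) i j :
  A i j ^+ 2 <= frobenius_norm A ^+ 2.
Proof.
have s0 k l : 0 <= A k l ^+ 2 by exact: sqr_ge0.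
rewrite sqr_sqrtr; last by apply: sumr_ge0 => k _; apply: sumr_ge0.
rewrite (bigD1 i)//= (bigD1 j)//= -addrA lerDl addr_ge0 ?sumr_ge0// => k _.
exact: sumr_ge0.
Qed.

Lemma pencil_entry1_continuous i j : continuous (fun p : pencil R m n => p.1 i j).
Proof.
move=> p; apply/(@cvgrPdist_lt _ _ _ _ (nbhs_filter p)) => e e0; near=> q.
apply: (@le_lt_trans _ _ `|p - q|).
  rewrite -sqrtr_sqr ler_wsqrtr// ler_wpDr ?sqr_ge0//.
  by have := sqr_entry_le_frobenius (p - q).1 i j; rewrite !mxE.
by near: q; exact: (@cvgr_dist_lt _ (pencil R m n) _ _ _ id p).
Unshelve. all: by end_near.
Qed.

Lemma pencil_entry2_continuous i j : continuous (fun p : pencil R m n => p.2 i j).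
Proof.
move=> p; apply/(@cvgrPdist_lt _ _ _ _ (nbhs_filter p)) => e e0; near=> q.
apply: (@le_lt_trans _ _ `|p - q|).
  rewrite -sqrtr_sqr ler_wsqrtr// ler_wpDl ?sqr_ge0//.
  by have := sqr_entry_le_frobenius (p - q).2 i j; rewrite !mxE.
by near: q; exact: (@cvgr_dist_lt _ (pencil R m n) _ _ _ id p).
Unshelve. all: by end_near.
Qed.

End EntryContinuity.

(** Projecting a closed set along a compact factor gives a closed set. *)
Lemma closed_singular_on_segment (R : realType) (n : nat) (a b : R -> R) :
  continuous a -> continuous b ->
  closed [set p : pencil R n n |
    exists2 s, s \in `[-1, 1] & \det (a s *: p.1 + b s *: p.2) = 0].
Proof.
move=> ca cb; rewrite -openC openE => p np; rewrite /interior.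
(* Compactness of the segment turns nonvanishing near each [(s, p)] into one neighborhood of [p]
   valid for all s. *)
have : \forall q \near p, `[-1, 1]%classic `<=`
    [set s | \det (a s *: q.1 + b s *: q.2) != 0].
  apply: ((compact_near_coveringP _).1 (@segment_compact R (-1) 1) _ _
    (fun (q : pencil R n n) s => \det (a s *: q.1 + b s *: q.2) != 0)
    (nbhs_filter p)) => s s1.
  have c : \det (a z.1 *: z.2.1 + b z.1 *: z.2.2)
      @[z --> filter_prod (nbhs s) (nbhs p)] --> \det (a s *: p.1 + b s *: p.2).
    apply: cvg_det => i j.
    rewrite [X in _ --> X]mxE [X in _ --> X + _]mxE [X in _ --> _ + X]mxE.
    under eq_cvg do rewrite 3!mxE.
    apply: cvgD; apply: cvgM.
    - by apply: (@cvg_comp _ _ _ fst a); [exact: cvg_fst|exact: ca].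
    - apply: (@cvg_comp _ _ _ snd (fun q : pencil R n n => q.1 i j)).
        exact: cvg_snd.
      exact: pencil_entry1_continuous.
    - by apply: (@cvg_comp _ _ _ fst b); [exact: cvg_fst|exact: cb].
    - apply: (@cvg_comp _ _ _ snd (fun q : pencil R n n => q.2 i j)).
        exact: cvg_snd.
      exact: pencil_entry2_continuous.
  apply: (cvgr_neq0 _ c).
  by apply/eqP => e; apply: np; exists s.
apply: filterS => q h [s s1 /eqP]; apply/negP.
exact: h.
Qed.

(** Dividing by the coordinate of larger absolute value covers the projective line by two compact
    charts, [(1, s)] and [(s, 1)] with s in [-1, 1]. *)
Lemma closed_Brs_corank1 (R : realType) (n : nat) : (0 < n)%N ->
  closed (Brs R n n n (n - 1)).
Proof.
move=> n0.
have -> : Brs R n n n (n - 1) =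
    [set p : pencil R n n |
      exists2 s, s \in `[-1, 1] & \det ((1 : R) *: p.1 + s *: p.2) = 0] `|`
    [set p : pencil R n n |
      exists2 s, s \in `[-1, 1] & \det (s *: p.1 + (1 : R) *: p.2) = 0].
  apply/seteqP; split=> [p /(mem_Brs_corank1 n0)[c [d [cd dp]]]|p]; last first.
    by case=> -[s _ ds]; apply/(mem_Brs_corank1 n0);
      [exists 1, s|exists s, 1]; rewrite oner_neq0 ?orbT.
  have scale (x y z : R) : z != 0 -> c = z * x -> d = z * y ->
      \det (x *: p.1 + y *: p.2) = 0.
    move=> z0 cE dE; move: dp; rewrite cE dE -!scalerA -scalerDr detZ => /eqP.
    by rewrite mulf_eq0 expf_eq0 (negbTE z0) andbF => /eqP.
  have itv (x y : R) : `|y| <= `|x| -> x != 0 -> y / x \in `[-1, 1].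
    move=> yx x0; rewrite in_itv /= -ler_norml normf_div ler_pdivrMr ?normr_gt0//.
    by rewrite mul1r.
  have [dc|/ltW dc] := leP `|d| `|c|.
    have c0 : c != 0.
      apply: contraTneq cd => c0; move: dc; rewrite c0 normr0 normr_le0 => ->.
      by rewrite eqxx.
    left; exists (d / c); first exact: itv.
    by apply: (scale _ _ c) => //; field.
  have d0 : d != 0.
    apply: contraTneq cd => d0; move: dc; rewrite d0 normr0 normr_le0 => ->.
    by rewrite eqxx.
  right; exists (c / d); first exact: itv.
  by apply: (scale _ _ d) => //; field.
by apply: closedU; apply: closed_singular_on_segment => ?;
  by [exact: cvg_cst|exact: cvg_id].
Qed.

Theorem theorem21 (R : realType) (k : nat) (hk : (0 < k)%N) :
  ~ closed (Brs R (2 * k) (2 * k) (2 * k - 1) (2 * k - 1)) /\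
  closure (Brs R (2 * k) (2 * k) (2 * k - 1) (2 * k - 1)) =
    Brs R (2 * k) (2 * k) (2 * k) (2 * k - 1).
Proof.
have n0 : (0 < 2 * k)%N by rewrite muln_gt0.
have cl : closure (Brs R (2 * k) (2 * k) (2 * k - 1) (2 * k - 1)) =
    Brs R (2 * k) (2 * k) (2 * k) (2 * k - 1).
  apply/seteqP; split; last first.
    by apply: Brs_corank1_sub_closure; rewrite // mul2n odd_double.
  have /closure_id-> := @closed_Brs_corank1 R _ n0.
  apply: closure_subset => p /(mem_Brs_corank11 n0)[a [b [c [d [dt _ dcd]]]]].
  apply/(mem_Brs_corank1 n0); exists c, d; split=> //.
  rewrite -negb_and; apply: contra dt => /andP[/eqP-> /eqP->].
  by rewrite !mulr0 subr0.
(* If the smaller set were closed, it would equal its closure, the larger set. *)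
split=> // /closure_id; rewrite cl => E.
(* [det (x I + y 0) = x ^ (2 k)] has a single projective root. *)
pose p : pencil R (2 * k) (2 * k) := (1%:M, 0).
have detp x y : \det (x *: p.1 + y *: p.2) = x ^+ (2 * k).
  by rewrite scaler0 addr0 detZ det1 mulr1.
have : Brs R (2 * k) (2 * k) (2 * k) (2 * k - 1) p.
  apply/(mem_Brs_corank1 n0); exists 0, 1; rewrite oner_neq0 orbT detp.
  by rewrite expr0n gtn_eqF.
rewrite -E => /(mem_Brs_corank11 n0)[a [b [c [d [dt]]]]].
rewrite !detp => /eqP + /eqP; rewrite !expf_eq0 n0 /= => /eqP a0 /eqP c0.
by move: dt; rewrite a0 c0 mul0r mulr0 subr0 eqxx.
Qed.
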